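(* Consider the linear network of the context with gains $\gamma_{ij}(s)=a_{ij}s$, where $a_{ij}\ge0$ satisfy the gain-allocation condition stated there, and let $A_\gamma=[a_{ij}]_{i,j=1}^\ell$. The following are equivalent: 1. Every directed simple cycle $(i_1,\dots,i_r)$ (distinct indices, $r\ge1$) satisfies $a_{i_1i_2}a_{i_2i_3}\cdots a_{i_ri_1}<1$. 2. There exist $p_i>0$, $i=1,\dots,\ell$, and $\theta\in(0,1)$ such that $a_{ij}p_j\le\theta p_i$ for every edge $(j,i)$ with $a_{ij}>0$. 3. There exist $y_i\in\mathbb R$ and $\vartheta<0$ such that $\log a_{ij}+y_j-y_i\le\vartheta$ for all $(i,j)$ with $a_{ij}>0$ (the relation with item 2 being $y_i=\log p_i$, $\vartheta=\log\theta$). When these conditions hold, with $p_i,\theta$ as in item 2, the functions $\sigma_i(s):=p_is$ satisfy $\sigma_i^{-1}\circ\gamma_{ij}\circ\sigma_j(s)\le\theta s$ for all $s\ge0$ and all $i,j$, and therefore $$V(x):=\max_{i}\frac{x_i^\top P_ix_i}{p_i}$$ obeys $V(A_K^Mx)\le\theta V(x)$ for all $x\in\mathbb R^n$.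
   Context: Linear network: $x(t+1)=Ax(t)+Bu(t)$, $x=(x_1,\dots,x_\ell)\in\mathbb R^n$, $A=[A_{ij}]$, $B=\operatorname{blkdiag}(B_1,\dots,B_\ell)$, $K=\operatorname{blkdiag}(K_1,\dots,K_\ell)$, $A_K=A+BK$, $M\in\mathbb N$, $A_K^M=[\Phi_{ij}(M)]_{i,j=1}^\ell$; $P_i=P_i^\top\succ0$; $c_{ij}(M)=\|P_i^{1/2}\Phi_{ij}(M)P_j^{-1/2}\|_2$ with principal square roots; $\mathcal J_i=\{j:c_{ij}(M)>0\}$. Gain-allocation condition: $a_{ij}>0$ for $j\in\mathcal J_i$ with $\sum_{j\in\mathcal J_i}c_{ij}(M)/\sqrt{a_{ij}}\le1$ for every $i$, and $a_{ij}=0$ for $j\notin\mathcal J_i$. The directed graph has an edge $(j,i)$ exactly when $a_{ij}>0$; self-loops count as cycles of length $r=1$. $A_K^Mx$ is the state reached from $x$ after $M$ steps under the finite-step feedback sequence $(Kx,KA_Kx,\dots,KA_K^{M-1}x)$. *)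

(* Defs.v *)
From HB Require Import structures.
From mathcomp Require Import all_boot all_order all_algebra.
From mathcomp Require Import all_classical all_reals all_analysis.
Set Implicit Arguments.
Unset Strict Implicit.
Unset Printing Implicit Defensive.
Import Order.TTheory GRing.Theory Num.Theory.
Local Open Scope classical_set_scope.
Local Open Scope ring_scope.

Definition qform (R : realType) (n : nat) (P : 'M[R]_n) (v : 'cV[R]_n) : R :=
  (v^T *m P *m v) 0 0.

Definition posdef (R : realType) (n : nat) (P : 'M[R]_n) : Prop :=
  P^T = P /\ forall v : 'cV[R]_n, v != 0 -> 0 < qform P v.

Definition possemidef (R : realType) (n : nat) (P : 'M[R]_n) : Prop :=
  P^T = P /\ forall v : 'cV[R]_n, 0 <= qform P v.

(* The principal square root: the symmetric positive semidefinite S with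
   S *m S = P. It exists and is unique when P is symmetric positive
   semidefinite; the default 0 is only reached for other P. *)
Definition sqrtmx (R : realType) (n : nat) (P : 'M[R]_n) : 'M[R]_n :=
  xget 0 [set S : 'M[R]_n | possemidef S /\ S *m S = P].

Definition norm2 (R : realType) (n : nat) (v : 'cV[R]_n) : R :=
  Num.sqrt (\sum_(i < n) v i 0 ^+ 2).

(* The spectral norm, induced by the Euclidean norms; the library norm on
   matrices is the entrywise maximum. The unit ball (rather than the unit
   sphere) keeps the set nonempty when n = 0. *)
Definition opnorm2 (R : realType) (m n : nat) (C : 'M[R]_(m, n)) : R :=
  sup [set norm2 (C *m v) | v in [set v : 'cV[R]_n | norm2 v <= 1]].

(* conform_mx 0 only transports B_ i : 'M_(p i, q i) to the type 'M_(p i, q j)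
   when i = j, as in the library's mxdiag, which is limited to square blocks. *)
Definition blkdiag (R : realType) (l : nat) (p q : 'I_l -> nat)
    (B_ : forall i, 'M[R]_(p i, q i)) : 'M[R]_(\sum_i p i, \sum_i q i) :=
  \mxblock_(i, j) (if i == j then conform_mx 0 (B_ i) else 0).

Definition closed_loop (R : realType) (l : nat) (n m : 'I_l -> nat)
    (A : 'M[R]_(\sum_i n i)) (B_ : forall i, 'M[R]_(n i, m i))
    (K_ : forall i, 'M[R]_(m i, n i)) : 'M[R]_(\sum_i n i) :=
  A + blkdiag B_ *m blkdiag K_.

Definition coupling (R : realType) (l : nat) (n : 'I_l -> nat)
    (P_ : forall i, 'M[R]_(n i)) (Phi : 'M[R]_(\sum_i n i)) (i j : 'I_l) : R :=
  opnorm2 (sqrtmx (P_ i) *m submxblock Phi i j *m invmx (sqrtmx (P_ j))).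

Definition gain_allocation (R : realType) (l : nat) (c : 'I_l -> 'I_l -> R)
    (a : 'M[R]_l) : Prop :=
  [/\ forall i j, 0 < c i j -> 0 < a i j,
      forall i, \sum_(j < l | 0 < c i j) c i j / Num.sqrt (a i j) <= 1
    & forall i j, ~~ (0 < c i j) -> a i j = 0].

Definition edge (R : realType) (l : nat) (a : 'M[R]_l) (j i : 'I_l) : bool :=
  0 < a i j.

(* (i_1, ..., i_r) is listed in the order of the product
   a_(i_1 i_2) ... a_(i_r i_1), so that each (i_(k+1), i_k) is an edge, with
   i_(r+1) = i_1; this traverses the cycle against its arrows. *)
Definition simple_cycle (R : realType) (l : nat) (a : 'M[R]_l)
    (s : seq 'I_l) : bool :=
  [&& s != [::], uniq s & cycle (fun i k => edge a k i) s].

Definition cycle_gain (R : realType) (l : nat) (a : 'M[R]_l)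
    (s : seq 'I_l) : R :=
  \prod_(i <- s) a i (next s i).

Definition cycle_condition (R : realType) (l : nat) (a : 'M[R]_l) : Prop :=
  forall s : seq 'I_l, simple_cycle a s -> cycle_gain a s < 1.

Definition scaling_condition (R : realType) (l : nat) (a : 'M[R]_l)
    (p : 'I_l -> R) (theta : R) : Prop :=
  [/\ forall i, 0 < p i,
      0 < theta < 1
    & forall i j, edge a j i -> a i j * p j <= theta * p i].

Definition potential_condition (R : realType) (l : nat) (a : 'M[R]_l)
    (y : 'I_l -> R) (vartheta : R) : Prop :=
  vartheta < 0 /\
  forall i j, 0 < a i j -> ln (a i j) + y j - y i <= vartheta.

Definition gain (R : realType) (l : nat) (a : 'M[R]_l) (i j : 'I_l) (s : R) : R :=
  a i j * s.

Definition sigma (R : realType) (l : nat) (p : 'I_l -> R) (i : 'I_l) (s : R) : R :=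
  p i * s.

(* The inverse of sigma_i as a function on [0, +oo). *)
Definition sigma_inv (R : realType) (l : nat) (p : 'I_l -> R) (i : 'I_l) : R -> R :=
  'pinv_(fun=> 0) [set s : R | 0 <= s] (sigma p i).

(* All terms are nonnegative in the intended use (P_ i positive definite and
   p i > 0), so the initial value 0 does not affect the maximum. *)
Definition maxV (R : realType) (l : nat) (n : 'I_l -> nat)
    (P_ : forall i, 'M[R]_(n i)) (p : 'I_l -> R) (x : 'cV[R]_(\sum_i n i)) : R :=
  \big[Num.max/0]_(i < l) (qform (P_ i) (submxcol x i) / p i).

(* Main.v *)
Require Import Defs.
From mathcomp Require Import all_boot all_order all_algebra.
From mathcomp Require Import complex ring lra.
From mathcomp Require Import all_classical all_reals all_analysis.
Set Implicit Arguments.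
Unset Strict Implicit.
Unset Printing Implicit Defensive.
Import Order.TTheory GRing.Theory Num.Theory.
Local Open Scope classical_set_scope.
Local Open Scope ring_scope.

(* Cycles and scalings: there are finitely many simple cycles, so some
   [t < 1] satisfies [gain <= t ^+ length] for all of them; with respect to
   the weights [a i j / t] no cycle gains, and the largest weight of a simple
   path from [i] serves as [p i]. Conversely the [p i] cancel along a cycle.

   Contraction: with [S_i] the square root of [P_i] and [z_i = S_i x_i], the
   block [i] of the next state has norm at most [\sum_j c_ij |z_j|]; since
   [a_ij |z_j|^2 <= theta p_i V], each [|z_j|] is at most
   [sqrt (theta p_i V) / sqrt a_ij], and the gain allocation sums the
   coefficients to at most 1. *)

(** * Walks, simple cycles and scalings *)

Fixpoint walk_weight (R : realType) (T : Type) (b : T -> T -> R) (i : T)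
    (s : seq T) : R :=
  if s is j :: s' then b i j * walk_weight b j s' else 1.

Lemma walk_weight_cat (R : realType) (T : Type) (b : T -> T -> R) i s1 j s2 :
  walk_weight b i (s1 ++ j :: s2) =
  walk_weight b i (rcons s1 j) * walk_weight b j s2.
Proof.
by elim: s1 i => [|k s1 IH] i /=; rewrite ?mulr1// IH mulrA.
Qed.

Lemma walk_weight_div (R : realType) (T : Type) (b : T -> T -> R) t i s :
  walk_weight (fun i j => b i j / t) i s = walk_weight b i s / t ^+ size s.
Proof.
elim: s i => [|k s IH] i /=; first by rewrite divr1.
by rewrite IH exprS invfM mulrACA.
Qed.

Lemma walk_weight_ge0 (R : realType) (T : Type) (b : T -> T -> R) i s :
  (forall i j, 0 <= b i j) -> 0 <= walk_weight b i s.
Proof. by move=> b0; elim: s i => //= k s IH i; rewrite mulr_ge0. Qed.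

Lemma cycle_gain_walk (R : realType) (l : nat) (a : 'M[R]_l) i s :
  uniq (i :: s) -> cycle_gain a (i :: s) = walk_weight a i (rcons s i).
Proof.
rewrite /cycle_gain /next.
(* The return point [i] stays fixed while the head [y] moves along the list. *)
suff H y : uniq (y :: s) ->
    \prod_(x <- y :: s) a x (next_at x i y s) = walk_weight a y (rcons s i).
  exact: H.
elim: s y => [|k s IH] y us.
  by rewrite big_seq1 /= eqxx mulr1.
rewrite big_cons /= eqxx; congr (_ * _).
rewrite -IH; last by case/andP: us.
apply: eq_big_seq => x xs.
by case: eqP xs us => // -> ys /= /andP[]; rewrite ys.
Qed.

Lemma uniq_size_card (T : finType) (s : seq T) : uniq s -> (size s <= #|T|)%N.
Proof. by move/card_uniqP <-; exact: max_card. Qed.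

(* The potential of [i] is the largest weight of a simple path starting at
   [i]; a path that returns to [i] contains a simple cycle that can be cut. *)
Lemma cycle_le1_potential (R : realType) (T : finType) (b : T -> T -> R) :
  (forall i j, 0 <= b i j) ->
  (forall i s, uniq (i :: s) -> walk_weight b i (rcons s i) <= 1) ->
  exists p : T -> R, (forall i, 0 < p i) /\ forall i j, b i j * p j <= p i.
Proof.
move=> b0 bc.
(* Bounded length makes the family of paths finite; the initial value 1 is the weight of the empty
   path. *)
pose p i := \big[Num.max/1]_(s : #|T|.-bseq T | uniq (i :: s)) walk_weight b i s.
have ple i s : uniq (i :: s) -> walk_weight b i s <= p i.
  move=> us; have ss : (size s <= #|T|)%N.
    by apply: uniq_size_card; case/andP: us.
  exact: (@le_bigmax_cond _ _ _ _ (Bseq ss) (fun s : #|T|.-bseq T => uniq (i :: s))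
    (fun s : #|T|.-bseq T => walk_weight b i s)).
have p_gt0 i : 0 < p i by rewrite (lt_le_trans ltr01)// (ple i [::]).
exists p; split=> // i j.
have := b0 i j; rewrite le_eqVlt => /predU1P[<-|bij]; first by rewrite mul0r ltW.
have key s : uniq (j :: s) -> b i j * walk_weight b j s <= p i.
  move=> us; have [|nis] := boolP (i \in j :: s); last first.
    by apply: (ple i (j :: s)); rewrite cons_uniq nis.
  rewrite -[b i j * _]/(walk_weight b i (j :: s)) => ijs; move: us.
  (* [s1] followed by [i] closes a simple cycle at [i], of weight at most 1; [s2] remains as a
     simple path from [i]. *)
  case/splitPr: ijs => s1 s2; rewrite cat_uniq => /and3P[us1 /= dis /andP[is2 us2]].
  rewrite walk_weight_cat.
  have ? : uniq (i :: s2) by rewrite /= is2.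
  apply: le_trans (ple i s2 _) => //.
  apply: ler_piMl; first exact: walk_weight_ge0.
  apply: bc; rewrite /= us1 andbT; apply: contra dis => ->//.
rewrite mulrC -ler_pdivlMr//; apply: bigmax_le => [|s us].
  by rewrite ler_pdivlMr// mul1r; have := key [::] isT; rewrite /= mulr1.
by rewrite ler_pdivlMr// mulrC key.
Qed.

(** The largest gain [g] is below 1, and its root [t] of order [l.+1] serves all lengths up to
    [l.+1], because the powers of [t] decrease. *)
Lemma cycle_condition_rate (R : realType) (l : nat) (a : 'M[R]_l) :
  (forall i j, 0 <= a i j) -> cycle_condition a ->
  exists2 t : R, 0 < t < 1 &
    forall i s, uniq (i :: s) -> cycle_gain a (i :: s) <= t ^+ size (i :: s).
Proof.
move=> a0 ca.
have lt1 i s : uniq (i :: s) -> cycle_gain a (i :: s) < 1.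
  move=> us.
  (* A list with a missing edge has gain 0, so the bound extends to all repetition-free lists. *)
  have [/allP as_gt0|/allPn[x xs nax]] :=
    boolP (all (fun x => 0 < a x (next (i :: s) x)) (i :: s)).
    by apply: ca; rewrite /simple_cycle us; exact: cycle_from_next.
  rewrite /cycle_gain (big_rem x)//=.
  suff -> : a x (next (i :: s) x) = 0 by rewrite mul0r.
  by apply/eqP; rewrite eq_le a0 andbT leNgt.
pose f i (s : l.-bseq 'I_l) := cycle_gain a (i :: s).
(* Starting from 1/2 keeps [g] positive even if all gains vanish. *)
pose g := \big[Num.max/2^-1]_(u : 'I_l * l.-bseq 'I_l | uniq (u.1 :: u.2))
  f u.1 u.2.
have g_gt0 : 0 < g by rewrite (lt_le_trans _ (bigmax_ge_id _ _ _ _))// invr_gt0.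
have g_lt1 : g < 1.
  by apply: bigmax_lt => [|[i s] /= us]; rewrite ?invf_lt1 ?ltr1n// lt1.
pose t := g `^ (l.+1%:R)^-1.
have t_gt0 : 0 < t by rewrite powR_gt0.
have tg : t ^+ l.+1 = g.
  by rewrite -powR_mulrn ?ltW// -powRrM mulVf ?pnatr_eq0// powRr1// ltW.
have t_lt1 : t < 1.
  by rewrite -(@expr_lt1 _ l.+1)// ?ltW// tg.
exists t => [|i s us]; first by rewrite t_gt0.
have := us; rewrite cons_uniq => /andP[_ /uniq_size_card]; rewrite card_ord => sl.
apply: (@le_trans _ _ g); last first.
  by rewrite -tg ler_wiXn2l// ltW.
exact: (@le_bigmax_cond _ _ _ _ (i, Bseq sl)
  (fun u : 'I_l * l.-bseq 'I_l => uniq (u.1 :: u.2))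
  (fun u => f u.1 u.2)).
Qed.

Lemma cycle_condition_scaling (R : realType) (l : nat) (a : 'M[R]_l) :
  (forall i j, 0 <= a i j) -> cycle_condition a ->
  exists p t, scaling_condition a p t.
Proof.
move=> a0 /(cycle_condition_rate a0)[t t01 at_].
have [t0 t1] := andP t01.
have [||p [p0 pa]] := @cycle_le1_potential R 'I_l (fun i j => a i j / t).
- by move=> i j; rewrite divr_ge0// ltW.
- move=> i s us; rewrite walk_weight_div size_rcons ler_pdivrMr ?exprn_gt0//.
  by rewrite mul1r -cycle_gain_walk// at_.
exists p, t; split=> // i j _.
by have := pa i j; rewrite mulrAC ler_pdivrMr// [p i * t]mulrC.
Qed.

(** [next s] permutes the entries of [s], with inverse [prev s]; this cancels the scalings along a
    cycle. *)
Lemma prod_next (R : realType) (T : eqType) (p : T -> R) (s : seq T) :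
  uniq s -> \prod_(i <- s) p (next s i) = \prod_(i <- s) p i.
Proof.
move=> us; rewrite -(big_map (next s) xpredT p); apply: perm_big.
apply: uniq_perm => // [|x].
  by rewrite map_inj_uniq//; exact: can_inj (prev_next us).
apply/mapP/idP => [[y ys ->]|xs]; first by rewrite mem_next.
by exists (prev s x); rewrite ?mem_prev ?next_prev.
Qed.

Lemma scaling_cycle_condition (R : realType) (l : nat) (a : 'M[R]_l) p t :
  scaling_condition a p t -> cycle_condition a.
Proof.
move=> [p0 /andP[t0 t1] pa] s /and3P[s0 us cs].
have prod_gt0 : 0 < \prod_(i <- s) p i by apply: prodr_gt0.
have ep i : i \in s -> 0 < a i (next s i) by exact: (next_cycle cs).
suff : cycle_gain a s <= t ^+ size s.
  by move/le_lt_trans; apply; rewrite exprn_ilt1 ?ltW// size_eq0.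
(* With the product of the [p i] as a factor, taken over successors on the left, the claim splits
   into one edge inequality per entry. *)
rewrite -(ler_pM2r prod_gt0) -{1}(prod_next p us) -big_split /=.
have -> : t ^+ size s = \prod_(i <- s) t.
  by rewrite big_const_seq count_predT -Monoid.iteropE.
rewrite -big_split /= !big_seq; apply: ler_prod => i /ep ai.
by rewrite pa// andbT mulr_ge0// ltW.
Qed.

(** * Existence of the principal square root *)

Lemma poly_interpolation (F : fieldType) (s : seq F) (f : F -> F) :
  uniq s -> exists g : {poly F}, forall x, x \in s -> g.[x] = f x.
Proof.
elim: s => [|x s IH] /=; first by exists 0.
move=> /andP[xs /IH[g gf]].
(* [q] vanishes at the earlier nodes but not at [x], so a multiple of it corrects the value at [x]
   alone. *)
pose q := \prod_(y <- s) ('X - y%:P).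
have qx : q.[x] != 0 by rewrite -rootE root_prod_XsubC.
exists (g + ((f x - g.[x]) / q.[x]) *: q) => y.
rewrite inE hornerD hornerZ => /predU1P[->|ys].
  by rewrite divfK// addrC subrK.
have /rootP-> : root q y by rewrite root_prod_XsubC.
by rewrite mulr0 addr0 gf.
Qed.

Lemma qform_mul_trmx (R : realType) n (P : 'M[R]_n) (v : 'cV[R]_n) :
  qform (P *m P^T) v = (\sum_i (P^T *m v) i 0 ^+ 2).
Proof.
rewrite /qform mulmxA -mulmxA -{1}[P]trmxK -trmx_mul mxE.
by apply: eq_bigr => i _; rewrite mxE expr2.
Qed.

(** At a row eigenvector the form is [r] times a sum of squares. *)
Lemma posdef_eigenvalue_gt0 (R : realType) n (P : 'M[R]_n) r :
  posdef P -> eigenvalue P r -> 0 < r.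
Proof.
move=> [PT P0] /eigenvalueP[v vP v0].
have vT0 : v^T != 0 by rewrite trmx_eq0.
have := P0 _ vT0; rewrite /qform trmxK vP -scalemxAl mxE.
apply: contraTT; rewrite -!leNgt => r0.
apply: mulr_le0_ge0 => //; rewrite mxE sumr_ge0// => i _.
by rewrite mxE -expr2 sqr_ge0.
Qed.

(* [d] lists the eigenvalues of [P] over R[i], where [P] is diagonalizable by
   the spectral theorem for Hermitian matrices; they are real. *)
Lemma symmetric_horner_mx (R : realType) n (P : 'M[R]_n.+1) : P^T = P ->
  exists2 d : seq R, (forall r, r \in d -> eigenvalue P r) &
   forall g : {poly R}, (forall r, r \in d -> g.[r] = r) -> horner_mx P g = P.
Proof.
move=> PT; pose f : {rmorphism R -> R[i]} := real_complex R.
pose PC := map_mx f P.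
have PCr : PC \is a realmx.
  by apply/mxOverP => i j; rewrite mxE; apply/complex_realP; exists (P i j).
have PCh : PC \is hermsymmx.
  apply: realsym_hermsym => //.
  by apply/is_hermitianmxP; rewrite expr0 scale1r map_mx_id// /PC -{1}PT map_trmx.
pose U := spectralmx PC; pose d := spectral_diag PC.
have Uu : U \in unitmx by exact: spectral_unit.
have PCE : PC = invmx U *m diag_mx d *m U.
  by apply/orthomx_spectralP; exact: hermitian_normalmx.
have /mxOverP dr := hermitian_spectral_diag_real PCh.
have dE i : f (complex.Re (d 0 i)) = d 0 i.
  by have /complex_realP[x ->] := dr 0 i.
exists [seq complex.Re (d 0 i) | i <- enum 'I_n.+1].
  move=> r /mapP[i _ ->]; rewrite -(eigenvalue_map f) dE.
  (* The rows of [U] are eigenvectors of [PC], nonzero because [U] is invertible. *)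
  apply/eigenvalueP; exists (row i U).
    rewrite -/PC PCE -row_mul !mulmxA mulmxV// mul1mx.
    by rewrite row_mul row_diag_mx -scalemxAl -rowE.
  apply/eqP => /(congr1 (mulmx^~ (invmx U))); rewrite -row_mul mulmxV// mul0mx.
  by move/rowP/(_ i); rewrite !mxE eqxx => /eqP; rewrite oner_eq0.
(* Over [R[i]], evaluation passes through the conjugation by [U] to the diagonal, whose entries [g]
   fixes. *)
move=> g gd; apply: (map_mx_inj (f := f)).
rewrite map_horner_mx -/PC PCE.
rewrite horner_mx_uconjC// horner_mx_diag; congr (_ *m diag_mx _ *m _).
apply/rowP => i; rewrite mxE -dE horner_map /= gd//.
by apply: map_f; rewrite mem_enum.
Qed.

(* With [g] interpolating the fourth root at the eigenvalues of [P], the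
   matrix [g(P)] squared is positive semidefinite because [g(P)] is symmetric,
   and its own square is [P]. *)
Lemma sqrtmx_exists (R : realType) n (P : 'M[R]_n) : posdef P ->
  exists S : 'M[R]_n, possemidef S /\ S *m S = P.
Proof.
case: n P => [|n] P Ppd.
  by exists 0; split; [split|]; rewrite ?[LHS]flatmx0 ?[RHS]flatmx0// => v;
     rewrite /qform mulmx0 mul0mx mxE.
have PT := Ppd.1.
have [d dP hornerP] := symmetric_horner_mx PT.
have [g gE] := poly_interpolation (fun r => Num.sqrt (Num.sqrt r)) (undup_uniq d).
pose Q := horner_mx P g.
have QT : Q^T = Q.
  (* Symmetry passes to polynomials in [P] by induction, as [P] commutes with them. *)
  rewrite /Q; elim/poly_ind: (g) => [|h c IH]; first by rewrite !rmorph0 trmx0.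
  rewrite rmorphD rmorphM /= horner_mx_X horner_mx_C linearD /= tr_scalar_mx.
  rewrite trmx_mul IH PT; congr (_ + _).
  by apply: comm_mx_horner; exact: comm_mx_refl.
exists (Q *m Q^T); split; first split.
- by rewrite trmx_mul trmxK.
- by move=> v; rewrite qform_mul_trmx sumr_ge0// => i _; rewrite sqr_ge0.
(* The eigenvalues are positive, so the fourth power of [g] fixes each of them. *)
- rewrite QT -[RHS](hornerP (g * g * (g * g))) ?rmorphM// => r rd.
  have r0 : 0 < r by exact: posdef_eigenvalue_gt0 (dP _ rd).
  rewrite !hornerM gE ?mem_undup// -!expr2 !sqr_sqrtr ?sqrtr_ge0//.
  exact: ltW.
Qed.

(** * Euclidean and spectral norms *)

Lemma norm2_ge0 (R : realType) n (v : 'cV[R]_n) : 0 <= norm2 v.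
Proof. exact: sqrtr_ge0. Qed.

Lemma sqr_norm2 (R : realType) n (v : 'cV[R]_n) :
  norm2 v ^+ 2 = \sum_i v i 0 ^+ 2.
Proof. by rewrite sqr_sqrtr// sumr_ge0// => i _; rewrite sqr_ge0. Qed.

Lemma norm2_0 (R : realType) n : norm2 (0 : 'cV[R]_n) = 0.
Proof.
by rewrite /norm2 big1 ?sqrtr0// => i _; rewrite mxE expr0n.
Qed.

Lemma norm2_eq0 (R : realType) n (v : 'cV[R]_n) : norm2 v = 0 -> v = 0.
Proof.
move/(congr1 (fun x => x ^+ 2)); rewrite sqr_norm2 expr0n /= => /eqP.
rewrite psumr_eq0 => [/allP v0|i _]; last exact: sqr_ge0.
apply/colP => i; rewrite mxE; apply/eqP.
by have := v0 i; rewrite mem_index_enum sqrf_eq0; exact.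
Qed.

Lemma norm2Z (R : realType) n k (v : 'cV[R]_n) : norm2 (k *: v) = `|k| * norm2 v.
Proof.
rewrite /norm2 -sqrtr_sqr -sqrtrM ?sqr_ge0// mulr_sumr.
by congr Num.sqrt; apply: eq_bigr => i _; rewrite mxE exprMn.
Qed.

(** Cauchy-Schwarz: for nonzero vectors, expand the squares of [norm2 v * u i 0 - norm2 u * v i 0]
    and divide by the product of the norms. *)
Lemma dot_le_norm2 (R : realType) n (u v : 'cV[R]_n) :
  \sum_i u i 0 * v i 0 <= norm2 u * norm2 v.
Proof.
have [/eqP/norm2_eq0->|u0] := boolP (norm2 u == 0).
  by rewrite norm2_0 mul0r big1// => i _; rewrite mxE mul0r.
have [/eqP/norm2_eq0->|v0] := boolP (norm2 v == 0).
  by rewrite norm2_0 mulr0 big1// => i _; rewrite mxE mulr0.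
have uv : 0 < norm2 u * norm2 v by rewrite mulr_gt0// lt0r norm2_ge0 andbT.
have : 0 <= \sum_i (norm2 v * u i 0 - norm2 u * v i 0) ^+ 2.
  by apply: sumr_ge0 => i _; exact: sqr_ge0.
have -> : \sum_i (norm2 v * u i 0 - norm2 u * v i 0) ^+ 2 =
    norm2 v ^+ 2 * (\sum_i u i 0 ^+ 2) + norm2 u ^+ 2 * (\sum_i v i 0 ^+ 2)
    - 2 * (norm2 u * norm2 v) * \sum_i u i 0 * v i 0.
  rewrite !mulr_sumr -big_split -sumrB /=; apply: eq_bigr => i _; ring.
rewrite -!sqr_norm2 => h; rewrite -(ler_pM2l uv); lra.
Qed.

Lemma norm2D (R : realType) n (u v : 'cV[R]_n) :
  norm2 (u + v) <= norm2 u + norm2 v.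
Proof.
rewrite -(ler_pXn2r (ltn0Sn 1)) ?nnegrE ?addr_ge0 ?norm2_ge0//.
rewrite sqrrD !sqr_norm2.
have -> : \sum_i (u + v) i 0 ^+ 2 =
    \sum_i u i 0 ^+ 2 + (\sum_i u i 0 * v i 0) *+ 2 + \sum_i v i 0 ^+ 2.
  by rewrite -sumrMnl -!big_split /=; apply: eq_bigr => i _; rewrite mxE sqrrD.
by rewrite lerD2r lerD2l lerMn2r dot_le_norm2.
Qed.

Lemma norm2_sum (R : realType) n (I : finType) (F : I -> 'cV[R]_n) :
  norm2 (\sum_i F i) <= \sum_i norm2 (F i).
Proof.
apply: (big_ind2 (fun v r => norm2 v <= r)) => [|v r w s vr ws|//].
  by rewrite norm2_0.
exact: le_trans (norm2D v w) (lerD vr ws).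
Qed.

Lemma opnorm2_has_sup (R : realType) m n (C : 'M[R]_(m, n)) :
  has_sup [set norm2 (C *m v) | v in [set v : 'cV[R]_n | norm2 v <= 1]].
Proof.
split; first by exists (norm2 (C *m 0)), 0 => //=; rewrite norm2_0.
(* Coordinates of [v] are at most 1 in absolute value, so each entry of [C *m v] is bounded by an
   absolute row sum. *)
exists (Num.sqrt (\sum_i (\sum_j `|C i j|) ^+ 2)) => _ [v /= v1 <-].
apply: ler_wsqrtr; apply: ler_sum => i _.
rewrite -[leLHS]real_normK ?num_real// ler_pXn2r ?nnegrE ?sumr_ge0//.
rewrite mxE (le_trans (ler_norm_sum _ _ _))//; apply: ler_sum => j _.
rewrite normrM ler_piMr// (le_trans _ v1)//.
rewrite -sqrtr_sqr; apply: ler_wsqrtr.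
by rewrite (bigD1 j)//= lerDl sumr_ge0// => k _; rewrite sqr_ge0.
Qed.

Lemma norm2_mulmx (R : realType) m n (C : 'M[R]_(m, n)) v :
  norm2 (C *m v) <= opnorm2 C * norm2 v.
Proof.
have [/eqP/norm2_eq0->|v0] := boolP (norm2 v == 0).
  by rewrite mulmx0 !norm2_0 mulr0.
have v_gt0 : 0 < norm2 v by rewrite lt0r v0 norm2_ge0.
rewrite -ler_pdivrMr//; apply: sup_upper_bound; first exact: opnorm2_has_sup.
exists ((norm2 v)^-1 *: v) => /=.
  by rewrite norm2Z normfV ger0_norm ?norm2_ge0// mulVf.
by rewrite -scalemxAr norm2Z normfV ger0_norm ?norm2_ge0// mulrC.
Qed.

(** * Square-root coordinates and the contraction of [maxV] *)

Lemma sqrtmxP (R : realType) n (P : 'M[R]_n) : posdef P ->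
  possemidef (sqrtmx P) /\ sqrtmx P *m sqrtmx P = P.
Proof.
by move=> /sqrtmx_exists SP; exact: (xgetPex 0 SP).
Qed.

Lemma qform_norm2 (R : realType) n (P : 'M[R]_n) v : posdef P ->
  qform P v = norm2 (sqrtmx P *m v) ^+ 2.
Proof.
move=> /sqrtmxP[[ST _] SS].
by rewrite sqr_norm2 -[in LHS]SS -{2}ST qform_mul_trmx ST.
Qed.

(** A row vector killed by the root makes the form vanish at its transpose, so it is zero. *)
Lemma sqrtmx_unit (R : realType) n (P : 'M[R]_n) : posdef P ->
  sqrtmx P \in unitmx.
Proof.
move=> Ppd; rewrite -row_free_unit -kermx_eq0.
apply/rowV0P => v /sub_kermxP vS; apply: contra_eq vS => v0.
have := Ppd.2 v^T; rewrite trmx_eq0 => /(_ v0).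
have [[ST _] _] := sqrtmxP Ppd.
rewrite qform_norm2// -{1}ST -trmx_mul => h.
by apply: contraTneq h => ->; rewrite trmx0 norm2_0 expr0n ltxx.
Qed.

Lemma submxcol_mulmx (R : realType) l (n : 'I_l -> nat) (Phi : 'M[R]_(\sum_i n i))
    (x : 'cV[R]_(\sum_i n i)) i :
  submxcol (Phi *m x) i = \sum_j submxblock Phi i j *m submxcol x j.
Proof.
rewrite -submxcol_mul -[submxcol Phi i]submxrowK -{1}[x]submxcolK.
rewrite mul_mxrow_mxcol; apply: eq_bigr => j _.
by rewrite submxblockEv.
Qed.

(** The level [r] is left free; the contraction takes [t * maxV P_ p x * p i]. *)
Lemma gain_allocation_bound (R : realType) l (n : 'I_l -> nat)
    (P_ : forall i, 'M[R]_(n i)) (Phi : 'M[R]_(\sum_i n i)) (a : 'M[R]_l) i r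
    (x : 'cV[R]_(\sum_i n i)) :
  (forall i, posdef (P_ i)) -> gain_allocation (coupling P_ Phi) a -> 0 <= r ->
  (forall j, 0 < a i j -> a i j * qform (P_ j) (submxcol x j) <= r) ->
  qform (P_ i) (submxcol (Phi *m x) i) <= r.
Proof.
move=> hP [ca sa _] r0 ar.
rewrite qform_norm2// -[leRHS]sqr_sqrtr// ler_pXn2r ?nnegrE ?norm2_ge0 ?sqrtr_ge0//.
have -> : sqrtmx (P_ i) *m submxcol (Phi *m x) i =
   \sum_j sqrtmx (P_ i) *m submxblock Phi i j *m invmx (sqrtmx (P_ j)) *m
     (sqrtmx (P_ j) *m submxcol x j).
  rewrite submxcol_mulmx mulmx_sumr; apply: eq_bigr => j _.
  by rewrite !mulmxA mulmxKV ?sqrtmx_unit.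
apply: le_trans (norm2_sum _) _.
apply: (@le_trans _ _ (\sum_(j < l | 0 < coupling P_ Phi i j)
    coupling P_ Phi i j / Num.sqrt (a i j) * Num.sqrt r)).
  rewrite [leRHS]big_mkcond /=; apply: ler_sum => j _.
  apply: le_trans (norm2_mulmx _ _) _; rewrite -/(coupling P_ Phi i j).
  (* A coupling that is not positive contributes at most 0, which leaves the indices of the gain
     allocation. *)
  case: ifPn => [c0|]; last first.
    by rewrite -leNgt => c0; apply: mulr_le0_ge0; rewrite ?norm2_ge0.
  rewrite -mulrA ler_pM2l// mulrC ler_pdivlMr ?sqrtr_gt0 ?ca//.
  rewrite mulrC -[norm2 _]ger0_norm ?norm2_ge0// -sqrtr_sqr -sqrtrM ?(ltW (ca _ _ c0))//.
    by rewrite ler_wsqrtr// -qform_norm2// ar// ca.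
by rewrite -mulr_suml ler_piMl ?sqrtr_ge0.
Qed.

Lemma maxV_contraction (R : realType) l (n : 'I_l -> nat)
    (P_ : forall i, 'M[R]_(n i)) (Phi : 'M[R]_(\sum_i n i)) (a : 'M[R]_l) p t
    (x : 'cV[R]_(\sum_i n i)) :
  (forall i, posdef (P_ i)) -> gain_allocation (coupling P_ Phi) a ->
  scaling_condition a p t -> maxV P_ p (Phi *m x) <= t * maxV P_ p x.
Proof.
move=> hP ga [p0 /andP[t0 _] pa].
have V0 : 0 <= maxV P_ p x by exact: bigmax_ge_id.
have tV0 : 0 <= t * maxV P_ p x by rewrite mulr_ge0// ltW.
apply: bigmax_le => // i _; rewrite ler_pdivrMr//.
apply: (gain_allocation_bound hP ga); first by rewrite mulr_ge0// ltW.
move=> j aij.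
have xV : qform (P_ j) (submxcol x j) <= maxV P_ p x * p j.
  by rewrite -ler_pdivrMr//; exact: (le_bigmax _ _ j).
apply: (@le_trans _ _ (a i j * (maxV P_ p x * p j))); first by rewrite ler_pM2l.
by rewrite mulrCA [leRHS]mulrAC [leRHS]mulrC ler_wpM2l// pa.
Qed.

(** * Scaled gains and the logarithmic form *)

(** [s] is the image of [s / p i], a point of the half-line, where [sigma p i] is injective. *)
Lemma sigma_invE (R : realType) l (p : 'I_l -> R) i s : 0 < p i -> 0 <= s ->
  sigma_inv p i s = s / p i.
Proof.
move=> p0 s0; have sE : s = sigma p i (s / p i) by rewrite /sigma mulrC divfK ?gt_eqF.
rewrite {1}sE /sigma_inv pinvKV//; last by rewrite inE /= divr_ge0// ltW.
by move=> x y _ _; apply: mulfI; rewrite gt_eqF.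
Qed.

Lemma scaling_gain_le (R : realType) l (a : 'M[R]_l) p t i j s :
  (forall i j, 0 <= a i j) -> scaling_condition a p t -> 0 <= s ->
  (sigma_inv p i \o gain a i j \o sigma p j) s <= t * s.
Proof.
move=> a0 [p0 /andP[t0 _] pa] s0.
rewrite /= sigma_invE// /gain /sigma; last by rewrite !mulr_ge0// ltW.
rewrite ler_pdivrMr// mulrA [leRHS]mulrAC ler_wpM2r//.
have := a0 i j; rewrite le_eqVlt => /predU1P[<-|/pa//].
by rewrite mul0r mulr_ge0// ltW.
Qed.

(** The logarithm is increasing and turns products into sums; [ln t < 0] encodes [t < 1]. *)
Lemma scaling_potential (R : realType) l (a : 'M[R]_l) p t :
  (forall i, 0 < p i) -> 0 < t ->
  scaling_condition a p t <-> potential_condition a (fun i => ln (p i)) (ln t).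
Proof.
move=> p0 t0.
have E i j : 0 < a i j ->
    (ln (a i j) + ln (p j) - ln (p i) <= ln t) = (a i j * p j <= t * p i).
  move=> aij; rewrite -lnM ?posrE// -ln_div ?posrE ?mulr_gt0//.
  by rewrite ler_ln ?posrE ?divr_gt0 ?mulr_gt0// ler_pdivrMr.
split=> [[_ /andP[_ t1] pa]|[t1 pa]].
  by split=> [|i j aij]; [apply: ln_lt0; rewrite t0|rewrite E// pa].
split=> // [|i j aij]; last by rewrite -E// pa.
by rewrite t0 ltNge; apply/negP => /ln_ge0; rewrite leNgt t1.
Qed.

Theorem lemma7 (R : realType) (l M : nat) (n m : 'I_l -> nat)
    (A : 'M[R]_(\sum_i n i))
    (B_ : forall i, 'M[R]_(n i, m i)) (K_ : forall i, 'M[R]_(m i, n i))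
    (P_ : forall i, 'M[R]_(n i)) (a : 'M[R]_l)
    (hP : forall i, posdef (P_ i))
    (ha0 : forall i j, 0 <= a i j)
    (ha : gain_allocation (coupling P_ (closed_loop A B_ K_ ^+ M)) a) :
  [/\ cycle_condition a <->
        (exists (p : 'I_l -> R) (theta : R), scaling_condition a p theta),
      (exists (p : 'I_l -> R) (theta : R), scaling_condition a p theta) <->
        (exists (y : 'I_l -> R) (vartheta : R), potential_condition a y vartheta),
      (forall (p : 'I_l -> R) (theta : R), (forall i, 0 < p i) -> 0 < theta ->
         (scaling_condition a p theta <->
          potential_condition a (fun i => ln (p i)) (ln theta)))
    & (forall (p : 'I_l -> R) (theta : R), scaling_condition a p theta ->
         (forall (i j : 'I_l) (s : R), 0 <= s ->
            (sigma_inv p i \o gain a i j \o sigma p j) s <= theta * s) /\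
         (forall x : 'cV[R]_(\sum_i n i),
            maxV P_ p (closed_loop A B_ K_ ^+ M *m x) <= theta * maxV P_ p x))].
Proof.
split.
- split; first exact: cycle_condition_scaling.
  by move=> [p [t]]; exact: scaling_cycle_condition.
- split=> [[p [t st]]|[y [t yt]]].
    exists (fun i => ln (p i)), (ln t).
    by apply/scaling_potential => //; case: st => // _ /andP[].
  (* Exponentials turn any potential into the logarithmic form of a scaling. *)
  exists (fun i => expR (y i)), (expR t).
  apply/scaling_potential => [i||]; rewrite ?expR_gt0// expRK.
  by under eq_fun do rewrite expRK.
- by move=> p t; exact: scaling_potential.
- move=> p t st; split=> [i j s s0|x]; first exact: scaling_gain_le.
  exact: maxV_contraction ha st.
Qed.
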